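(* As formal power series in $q$ (equivalently, as analytic functions for $|q|<1$), $$\sum_{n\ge1}\frac{q^n}{(1-q^n)\,(1-q^n)(1-q^{n+1})\cdots(1-q^{2n-1})\,(q^{3n};q^3)_{\infty}}=\frac{1}{(q^3;q^3)_{\infty}}\sum_{n\ge1}\frac{nq^n}{1-q^n}-\frac{1}{2}\sum_{n\ge1}N_2(n)q^{3n}.$$
   Context: For $a\in\mathbb{C}$, $(a;q)_n=\prod_{k=0}^{n-1}(1-aq^k)$ and $(a;q)_\infty=\prod_{k\ge0}(1-aq^k)$. The rank of an integer partition is its largest part minus its number of parts. For integers $m$ and $n\ge1$, $N(m,n)$ denotes the number of partitions of $n$ with rank $m$, and $N_2(n)=\sum_{m\in\mathbb{Z}}m^2N(m,n)$ is the second Atkin–Garvan rank moment. *)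

(* Defs.v *)
From HB Require Import structures.
From mathcomp Require Import all_boot all_order all_algebra.
From mathcomp Require Import boolp classical_sets functions fsbigop.
From mathcomp Require cardinality.
From mathcomp Require Import zify.

Set Implicit Arguments.
Unset Strict Implicit.
Unset Printing Implicit Defensive.

Import Order.TTheory GRing.Theory Num.Theory.
Local Open Scope ring_scope.

(* A wrapper record, because [nat -> R] already carries the pointwise ring
   structure. *)
Record fps (R : Type) := Fps { fcoef : nat -> R }.

Lemma fpsP (R : Type) (f g : fps R) : fcoef f =1 fcoef g -> f = g.
Proof. by case: f g => [f] [g] /= /funext ->. Qed.

HB.instance Definition _ (R : Type) := gen_eqMixin (fps R).
HB.instance Definition _ (R : Type) := gen_choiceMixin (fps R).

Section FpsRing.
Variable R : comNzRingType.
Implicit Types f g h : fps R.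

Definition fps_zero : fps R := Fps (fun=> 0).
Definition fps_opp f : fps R := Fps (fun n => - fcoef f n).
Definition fps_add f g : fps R := Fps (fun n => fcoef f n + fcoef g n).
Definition fps_one : fps R := Fps (fun n => (n == 0%N)%:R).
Definition fps_mul f g : fps R :=
  Fps (fun n => \sum_(i < n.+1) fcoef f i * fcoef g (n - i)).

Fact fps_addA : associative fps_add.
Proof. by move=> f g h; apply: fpsP => n /=; rewrite addrA. Qed.
Fact fps_addC : commutative fps_add.
Proof. by move=> f g; apply: fpsP => n /=; rewrite addrC. Qed.
Fact fps_add0 : left_id fps_zero fps_add.
Proof. by move=> f; apply: fpsP => n /=; rewrite add0r. Qed.
Fact fps_addN : left_inverse fps_zero fps_opp fps_add.
Proof. by move=> f; apply: fpsP => n /=; rewrite addNr. Qed.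

HB.instance Definition _ :=
  GRing.isZmodule.Build (fps R) fps_addA fps_addC fps_add0 fps_addN.

Definition fps_trunc (N : nat) f : {poly R} := \poly_(i < N) fcoef f i.

Fact coef_fps_trunc_mul N f g k : (k < N)%N ->
  fcoef (fps_mul f g) k = (fps_trunc N f * fps_trunc N g)`_k.
Proof.
move=> ltkN; rewrite coefM /=; apply: eq_bigr => i _.
rewrite !coef_poly (leq_ltn_trans (leq_subr _ _) ltkN).
by rewrite (leq_ltn_trans _ ltkN) // -ltnS.
Qed.

Fact fps_mulC : commutative fps_mul.
Proof.
move=> f g; apply: fpsP => k.
by rewrite !(coef_fps_trunc_mul _ _ (ltnSn k)) mulrC.
Qed.

Fact fps_mulA : associative fps_mul.
Proof.
move=> f g h; apply: fpsP => k.
pose t := fps_trunc k.+1.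
transitivity ((t f * (t g * t h))`_k).
  rewrite coefM; apply: eq_bigr => i _.
  rewrite coef_poly ltn_ord (@coef_fps_trunc_mul k.+1) //.
  by rewrite ltnS leq_subr.
rewrite mulrA coefM; apply: eq_bigr => i _.
by rewrite -coef_fps_trunc_mul // coef_poly ltnS leq_subr.
Qed.

Fact fps_mul1 : left_id fps_one fps_mul.
Proof.
move=> f; apply: fpsP => n /=.
rewrite big_ord_recl /= mul1r subn0 big1 ?addr0 // => i _.
by rewrite mul0r.
Qed.

Fact fps_mulDl : left_distributive fps_mul fps_add.
Proof.
move=> f g h; apply: fpsP => n /=.
by rewrite -big_split; apply: eq_bigr => i _; rewrite mulrDl.
Qed.

Fact fps_one_neq0 : fps_one != fps_zero.
Proof.
apply/eqP => /(congr1 (fun f => fcoef f 0)) /= /eqP.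
by rewrite oner_eq0.
Qed.

HB.instance Definition _ := GRing.Zmodule_isComNzRing.Build (fps R)
  fps_mulA fps_mulC fps_mul1 fps_mulDl fps_one_neq0.

(* See [fps_unitE] below: [f] is invertible iff its constant term is. *)
Definition fps_unit : {pred fps R} := fun f => `[< exists g, g * f = 1 >].
Definition fps_inv f : fps R := xget f [set g | g * f = 1].

Fact fps_mulVx : {in fps_unit, left_inverse 1 fps_inv *%R}.
Proof. by move=> f /asboolP /xgetPex; apply. Qed.
Fact fps_unitPl f g : g * f = 1 -> fps_unit f.
Proof. by move=> gf1; apply/asboolP; exists g. Qed.
Fact fps_invr_out : {in [predC fps_unit], fps_inv =1 id}.
Proof. by move=> f /asboolP nf; apply: xgetPN => g gf1; apply: nf; exists g. Qed.

HB.instance Definition _ := GRing.ComNzRing_hasMulInverse.Build (fps R)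
  fps_mulVx fps_unitPl fps_invr_out.

Definition fpsX : fps R := Fps (fun n => (n == 1%N)%:R).

Lemma fcoefM f g n :
  fcoef (f * g) n = \sum_(i < n.+1) fcoef f i * fcoef g (n - i).
Proof. by []. Qed.

Lemma fcoefD f g n : fcoef (f + g) n = fcoef f n + fcoef g n.
Proof. by []. Qed.

Lemma fcoefN f n : fcoef (- f) n = - fcoef f n.
Proof. by []. Qed.

Lemma fcoef_sum (I : Type) (r : seq I) (P : pred I) (F : I -> fps R) n :
  fcoef (\sum_(i <- r | P i) F i) n = \sum_(i <- r | P i) fcoef (F i) n.
Proof. by elim/big_rec2: _ => // i x y _ <-. Qed.

Lemma fcoefXM f n :
  fcoef (fpsX * f) n = if (n == 0)%N then 0 else fcoef f n.-1.
Proof.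
rewrite fcoefM; case: n => [|n]; first by rewrite big_ord1 mul0r.
rewrite big_ord_recl mul0r add0r big_ord_recl /= mul1r big1 ?addr0 ?subn1 //.
by move=> i _; rewrite mul0r.
Qed.

Lemma fcoefXnM m f n :
  fcoef (fpsX ^+ m * f) n = if (n < m)%N then 0 else fcoef f (n - m).
Proof.
elim: m n => [|m IHm] n; first by rewrite expr0 mul1r subn0.
by rewrite exprS -mulrA fcoefXM; case: n => //= n; rewrite IHm.
Qed.

Definition fps_cvg (u : nat -> fps R) (l : fps R) : Prop :=
  forall k, exists N0, forall N, (N0 <= N)%N -> fcoef (u N) k = fcoef l k.

Definition fps_lim (u : nat -> fps R) : fps R := xget 0 [set l | fps_cvg u l].

Definition fps_sum (m : nat) (F : nat -> fps R) : fps R :=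
  fps_lim (fun N => \sum_(m <= n < N) F n).

Definition qpoch (a p : fps R) (n : nat) : fps R :=
  \prod_(0 <= k < n) (1 - a * p ^+ k).

Definition qpoch_inf (a p : fps R) : fps R := fps_lim (qpoch a p).

Lemma fps_cvg_lim u l : fps_cvg u l -> fps_lim u = l.
Proof.
move=> ul; apply: xget_unique => // l' ul'; apply: fpsP => k.
have [N hN] := ul k; have [N' hN'] := ul' k.
by rewrite -(hN _ (leq_maxl N N')) -(hN' _ (leq_maxr N N')).
Qed.

Lemma fcoef_fps_lim u :
  (forall k N, (k < N)%N -> fcoef (u N.+1) k = fcoef (u N) k) ->
  forall k N, (k < N)%N -> fcoef (fps_lim u) k = fcoef (u N) k.
Proof.
move=> uS.
have u_stable k N : (k < N)%N -> fcoef (u k.+1) k = fcoef (u N) k.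
  move=> /subnKC <-; elim: (N - k.+1)%N => [|d IHd]; first by rewrite addn0.
  by rewrite addnS [RHS]uS // leq_addr.
have ul : fps_cvg u (Fps (fun k => fcoef (u k.+1) k)).
  by move=> k; exists k.+1 => N /u_stable.
by move=> k N /u_stable <-; rewrite (fps_cvg_lim ul).
Qed.

Lemma fps_cvg_stable u :
  (forall k N, (k < N)%N -> fcoef (u N.+1) k = fcoef (u N) k) ->
  fps_cvg u (fps_lim u).
Proof. by move=> uS k; exists k.+1 => N /(fcoef_fps_lim uS). Qed.

Lemma fps_cvg_sum m F :
  (forall n k, (m <= n)%N -> (k < n)%N -> fcoef (F n) k = 0) ->
  fps_cvg (fun N => \sum_(m <= n < N) F n) (fps_sum m F).
Proof.
move=> F0; apply: fps_cvg_stable => k N ltkN.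
have [lemN|ltNm] := leqP m N; last by rewrite !big_geq // ltnW.
by rewrite big_nat_recr // fcoefD F0 ?addr0.
Qed.

Lemma fps_cvg_qpoch (a p : fps R) : fcoef p 0 = 0 ->
  fps_cvg (qpoch a p) (qpoch_inf a p).
Proof.
move=> p0; apply: fps_cvg_stable => k N ltkN.
pose p' : fps R := Fps (fun n => fcoef p n.+1).
have -> : p = fpsX * p' by apply: fpsP => -[|n]; rewrite fcoefXM.
have qpochS b n : qpoch a b n.+1 = qpoch a b n * (1 - a * b ^+ n).
  by rewrite /qpoch big_nat_recr.
rewrite qpochS mulrBr mulr1 fcoefD fcoefN exprMn.
by rewrite [a * _]mulrCA [qpoch _ _ _ * _]mulrCA fcoefXnM ltkN oppr0 addr0.
Qed.

End FpsRing.

Arguments fpsX {R}.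

Lemma fps_unitE (R : comUnitRingType) (f : fps R) :
  (f \is a GRing.unit) = (fcoef f 0 \is a GRing.unit).
Proof.
apply/idP/idP => [/mulrV /(congr1 (fun g => fcoef g 0))|f0U].
  by rewrite fcoefM big_ord1 => f0V; apply/unitrPr; exists (fcoef f^-1 0).
pose c : fps R := Fps (fun n => if n == 0%N then (fcoef f 0)^-1 else 0).
have fcoef_cM g n : fcoef (c * g) n = (fcoef f 0)^-1 * fcoef g n.
  rewrite fcoefM big_ord_recl subn0 big1 ?addr0 // => i _.
  by rewrite mul0r.
pose h : fps R := Fps (fun n => - fcoef (c * f) n.+1).
have cf : c * f = 1 - fpsX * h.
  apply: fpsP => n; rewrite fcoefD fcoefN fcoefXM.
  case: n => [|n]; first by rewrite fcoef_cM mulVr //= subr0.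
  by rewrite /= opprK add0r.
pose u N := \sum_(0 <= n < N) (fpsX * h) ^+ n.
have uS k N : (k < N)%N -> fcoef (u N.+1) k = fcoef (u N) k.
  move=> ltkN; rewrite /u big_nat_recr // fcoefD exprMn fcoefXnM ltkN.
  by rewrite addr0.
have cfu : c * f * fps_lim u = 1.
  apply: fpsP => k; transitivity (fcoef (c * f * u k.+1) k).
    rewrite !fcoefM; apply: eq_bigr => i _; congr (_ * _).
    by rewrite (fcoef_fps_lim uS (N := k.+1)) // ltnS leq_subr.
  have -> : c * f * u k.+1 = 1 - (fpsX * h) ^+ k.+1.
    by rewrite cf /u big_mkord -[RHS]opprB subrX1 -[RHS]mulNr opprB.
  by rewrite exprMn fcoefD fcoefN fcoefXnM ltnSn oppr0 addr0.
by apply/unitrPr; exists (c * fps_lim u); rewrite mulrA [f * c]mulrC.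
Qed.

Definition is_partition (n : nat) (s : seq nat) : bool :=
  [&& sorted geq s, 0%N \notin s & sumn s == n].

Definition rank (s : seq nat) : int := (\max_(x <- s) x)%N%:Z - (size s)%:Z.

(* A partition of [n] has at most [n] parts, all at most [n] (see
   [partition_bseq]), so it may be sought in the finite type of sequences of
   length at most [n] with entries in {0, ..., n}. *)
Definition rank_count (m : int) (n : nat) : nat :=
  #|[set s : n.-bseq 'I_n.+1 | is_partition n (map val s)
                                & rank (map val s) == m]|.

(* [\sum_(m \in setT)] is the finitely supported sum; its support is finite by
   [rank_count_finite]. *)
Definition rank_moment2 (n : nat) : int :=
  \sum_(m \in [set: int]) m ^+ 2 * (rank_count m n)%:Z.

Lemma partition_bseq n s : is_partition n s ->
  exists t : n.-bseq 'I_n.+1, map val t = s.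
Proof.
case/and3P=> _ s_gt0 /eqP s_n.
have le_size : (size s <= n)%N.
  rewrite -s_n; elim: s s_gt0 {s_n} => //= x s IHs.
  by rewrite inE negb_or eq_sym -lt0n => /andP[x_gt0 /IHs]; lia.
have le_parts x : x \in s -> (x < n.+1)%N.
  rewrite ltnS -s_n; elim: s {s_gt0 s_n le_size} => //= y s IHs.
  by rewrite inE => /predU1P[->|/IHs]; lia.
have size_t : (size (map (@inord n) s) <= n)%N by rewrite size_map.
exists (Bseq size_t); rewrite /= -map_comp -[RHS]map_id.
by apply/eq_in_map => x /le_parts xn /=; rewrite inordK.
Qed.

Lemma rank_count_finite n :
  cardinality.finite_set [set m | rank_count m n != 0%N].
Proof.
pose rk (s : n.-bseq 'I_n.+1) := rank (map val s).
apply: (@cardinality.sub_finite_set _ _ (rk @` setT)%classic); last first.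
  exact/cardinality.finite_image/cardinality.finite_finset.
move=> m /=; rewrite -lt0n => /card_gt0P[s].
by rewrite inE => /andP[_ /eqP <-]; exists s.
Qed.

(* Main.v *)
Require Import Defs.
From mathcomp Require Import all_boot all_order all_algebra.
From mathcomp Require Import fsbigop zify ring.
From mathcomp Require classical_sets.

Set Implicit Arguments.
Unset Strict Implicit.
Unset Printing Implicit Defensive.

Import GRing.Theory Num.Theory.
Local Open Scope ring_scope.

(* Multiply through by (q^3; q^3)_oo. The n-th summand on the left becomes
   q^n (q)_{n-1}^2 beta_n, where, by a three-term recurrence over the residues
   of k mod 3,
     beta_n = (q^3; q^3)_{n-1} / ((q)_n (q)_{2n-1})
            = sum_{3 | k} (-1)^k q^(k(k-1)/2) / ((q)_{n-k} (q)_{n+k}),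
   k ranging over the integers. Exchanging the sums, the sum over n telescopes
   for every k <> 0, because
     (1-q^n)^2 - (1-q^(n-k)) (1-q^(n+k)) = q^(n-k) (1-q^k)^2.
   The term k = 0 is the Lambert series. The other ones sum to -(p)_oo/2 times
   the generating function of the second rank moment in p = q^3, by Dyson's
   argument: the generating function G_m of the partitions with rank >= m
   satisfies
     G_m = p^(m+1) (1/(p)_oo - G_{m+3}),
   whose iteration is a pentagonal-type series, while half of the second rank
   moment is sum_{m >= 1} (2m-1) G_m by the symmetry of the rank. *)

(** * Congruences of power series modulo X^N *)

Section Congruence.
Variable R : comUnitRingType.
Implicit Types (f g h p : fps R) (N k m n : nat).

(** Congruence modulo X^N: limits, infinite products and infinite sums all get replaced by finite
    truncations, and [eqfps0] recovers equality from all N. *)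
Definition eqfps N f g : Prop := forall k, (k < N)%N -> fcoef f k = fcoef g k.

Lemma eq_eqfps N f g : f = g -> eqfps N f g.
Proof. by move->. Qed.

Lemma eqfps_sym N f g : eqfps N f g -> eqfps N g f.
Proof. by move=> fg k ltkN; rewrite fg. Qed.

Lemma eqfps_trans N g f h : eqfps N f g -> eqfps N g h -> eqfps N f h.
Proof. by move=> fg gh k ltkN; rewrite fg // gh. Qed.

Lemma eqfps_le M N f g : (M <= N)%N -> eqfps N f g -> eqfps M f g.
Proof. by move=> leMN fg k ltkM; rewrite fg // (leq_trans ltkM). Qed.

Lemma eqfpsD N f f' g g' :
  eqfps N f f' -> eqfps N g g' -> eqfps N (f + g) (f' + g').
Proof. by move=> ff' gg' k ltkN; rewrite !fcoefD ff' ?gg'. Qed.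

Lemma eqfpsN N f f' : eqfps N f f' -> eqfps N (- f) (- f').
Proof. by move=> ff' k ltkN; rewrite !fcoefN ff'. Qed.

Lemma eqfpsB N f f' g g' :
  eqfps N f f' -> eqfps N g g' -> eqfps N (f - g) (f' - g').
Proof. by move=> ff' gg'; apply: eqfpsD => //; apply: eqfpsN. Qed.

Lemma eqfpsM N f f' g g' :
  eqfps N f f' -> eqfps N g g' -> eqfps N (f * g) (f' * g').
Proof.
move=> ff' gg' k ltkN; rewrite !fcoefM; apply: eq_bigr => i _.
have leik : (i <= k)%N by rewrite -ltnS.
by rewrite ff' ?gg' // ?(leq_ltn_trans _ ltkN) // leq_subr.
Qed.

Lemma eqfpsMl N f g h : eqfps N f g -> eqfps N (h * f) (h * g).
Proof. exact: eqfpsM. Qed.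

Lemma eqfps_sum N (I : Type) (r : seq I) (P : pred I) (F G : I -> fps R) :
  (forall i, P i -> eqfps N (F i) (G i)) ->
  eqfps N (\sum_(i <- r | P i) F i) (\sum_(i <- r | P i) G i).
Proof.
by move=> FG k ltkN; rewrite !fcoef_sum; apply: eq_bigr => i Pi; apply: FG.
Qed.

Lemma eqfps0 f g : (forall N, eqfps N f g) -> f = g.
Proof. by move=> fg; apply: fpsP => k; apply: (fg k.+1). Qed.

Lemma eqfps_unit N u f g : u \is a GRing.unit ->
  eqfps N (u * f) (u * g) -> eqfps N f g.
Proof. by move=> uU /(eqfpsMl u^-1); rewrite !mulKr. Qed.

Lemma fcoef0_pow_factor p n : fcoef p 0 = 0 ->
  exists p', p ^+ n = fpsX ^+ n * p' ^+ n.
Proof.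
move=> p0; exists (Fps (fun n => fcoef p n.+1)).
rewrite -exprMn; congr (_ ^+ n).
by apply: fpsP => -[|k]; rewrite fcoefXM.
Qed.

Lemma eqfps_pow0 N p n f : fcoef p 0 = 0 -> (N <= n)%N ->
  eqfps N (p ^+ n * f) 0.
Proof.
move=> p0 leNn k ltkN; have [p' ->] := fcoef0_pow_factor n p0.
by rewrite -mulrA fcoefXnM (leq_trans ltkN leNn).
Qed.

(** X divides p, so a factor p^j gains j orders of precision. This offsets the precision lost in
    limits such as [qbaileyV_lim]. *)
Lemma eqfps_pow_shift N p j f g : fcoef p 0 = 0 -> eqfps N f g ->
  eqfps (N + j) (p ^+ j * f) (p ^+ j * g).
Proof.
move=> p0 fg k ltk; have [p' ->] := fcoef0_pow_factor j p0.
rewrite -!mulrA !fcoefXnM; case: ltnP => // lejk.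
by apply: (eqfpsMl (p' ^+ j) fg); lia.
Qed.

Lemma fcoefX0 : fcoef (fpsX : fps R) 0 = 0.
Proof. by []. Qed.

Lemma fcoef_pow0 p n : fcoef p 0 = 0 -> (0 < n)%N -> fcoef (p ^+ n) 0 = 0.
Proof. by move=> p0 n0; rewrite -[p ^+ n]mulr1 (@eqfps_pow0 1). Qed.

Lemma unit_subX p n : fcoef p 0 = 0 -> (0 < n)%N ->
  1 - p ^+ n \is a GRing.unit.
Proof.
by move=> p0 n0; rewrite fps_unitE fcoefD fcoefN fcoef_pow0 // subr0 unitr1.
Qed.

Lemma qpoch0 (a p : fps R) : qpoch a p 0 = 1.
Proof. by rewrite /qpoch big_nil. Qed.

Lemma qpoch_recr (a p : fps R) n :
  qpoch a p n.+1 = qpoch a p n * (1 - a * p ^+ n).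
Proof. by rewrite /qpoch big_nat_recr. Qed.

Lemma qpoch_cat (a p : fps R) m n :
  qpoch a p (m + n) = qpoch a p m * qpoch (a * p ^+ m) p n.
Proof.
elim: n => [|n IHn]; first by rewrite addn0 /qpoch big_nil mulr1.
by rewrite addnS !qpoch_recr IHn -!mulrA -exprD.
Qed.

Lemma qpoch_eq1 N (a p : fps R) j n : fcoef p 0 = 0 -> (N <= j)%N ->
  eqfps N (qpoch (a * p ^+ j) p n) 1.
Proof.
move=> p0 leNj; elim: n => [|n IHn]; first by rewrite /qpoch big_nil.
rewrite qpoch_recr -[X in eqfps _ _ X]mulr1; apply: eqfpsM IHn _.
rewrite -[X in eqfps _ _ X]subr0; apply: eqfpsB => //.
by rewrite -mulrA mulrCA; apply: eqfps_pow0.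
Qed.

Lemma qpoch_stable p m n : fcoef p 0 = 0 ->
  eqfps m (qpoch p p (m + n)) (qpoch p p m).
Proof.
move=> p0; rewrite qpoch_cat -[X in eqfps _ _ X]mulr1.
exact/eqfpsMl/qpoch_eq1.
Qed.

Lemma qpoch_infE N (a p : fps R) n : fcoef p 0 = 0 -> (N <= n)%N ->
  eqfps N (qpoch_inf a p) (qpoch a p n).
Proof.
move=> p0 leNn k ltkN; have [N0 cvgN0] := fps_cvg_qpoch a p0 k.
rewrite -(cvgN0 (n + N0)%N) ?leq_addl // qpoch_cat.
by rewrite (eqfpsMl _ (qpoch_eq1 a N0 p0 leNn)) // mulr1.
Qed.

Lemma qpoch_inf_split (a p : fps R) n : fcoef p 0 = 0 ->
  qpoch_inf a p = qpoch a p n * qpoch_inf (a * p ^+ n) p.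
Proof.
move=> p0; apply: eqfps0 => N.
apply: (@eqfps_trans _ (qpoch a p (n + N))).
  by apply: qpoch_infE; rewrite ?leq_addl.
by rewrite qpoch_cat; apply/eqfpsMl/eqfps_sym/qpoch_infE.
Qed.

Lemma qpoch_unit p n : fcoef p 0 = 0 -> qpoch p p n \is a GRing.unit.
Proof.
move=> p0; elim: n => [|n IHn]; first by rewrite /qpoch big_nil unitr1.
by rewrite qpoch_recr unitrM IHn -exprS unit_subX.
Qed.

Lemma qpoch_inf_unit p n : fcoef p 0 = 0 ->
  qpoch_inf (p ^+ n.+1) p \is a GRing.unit.
Proof.
move=> p0; rewrite fps_unitE (@qpoch_infE 1 _ _ 1) //.
rewrite /qpoch big_nat1 expr0 mulr1 fcoefD fcoefN fcoef_pow0 //.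
by rewrite subr0 unitr1.
Qed.

(** Terms with n >= N are multiples of X^N, so the sum may stop at N. *)
Lemma fps_sumE N m (F : nat -> fps R) :
  (forall n, (m <= n)%N -> exists g, F n = fpsX ^+ n * g) ->
  eqfps N (fps_sum m F) (\sum_(m <= n < N) F n).
Proof.
move=> Fdiv k ltkN.
have F0 n j : (m <= n)%N -> (j < n)%N -> fcoef (F n) j = 0.
  by move=> /Fdiv[g ->] ltjn; rewrite fcoefXnM ltjn.
have [N0 cvgN0] := fps_cvg_sum F0 k.
rewrite -(cvgN0 (N + N0)%N) ?leq_addl //.
elim: N0 {cvgN0} => [|N0 IHN0]; first by rewrite addn0.
rewrite addnS; have [lemN|ltNm] := leqP m (N + N0).
  rewrite big_nat_recr // fcoefD IHN0 F0 ?addr0 //.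
  by rewrite (leq_trans ltkN) ?leq_addr.
by rewrite !big_geq //; lia.
Qed.

End Congruence.

(** * The Bailey pair and its telescoping sum *)

Section CubicBaileyPair.
Variable R : comUnitRingType.
Implicit Types (N K k n r x y : nat).

Let q : fps R := fpsX.

Definition qfact n : fps R := qpoch q q n.

(* The index is shifted by one, so that [qfactV 0] stands for 1/(q)_{-1} = 0. *)
Definition qfactV x : fps R := if x is x'.+1 then (qfact x')^-1 else 0.

Arguments qfactV : simpl never.

(* 1/((q)_{n-k} (q)_{n+k}), which is 0 for n < k: the truncated subtraction
   then yields the junk index 0 of [qfactV]. *)
Definition qbaileyV n k : fps R := qfactV (n.+1 - k) * qfactV (n + k).+1.

Lemma qfact_unit n : qfact n \is a GRing.unit.
Proof. exact: qpoch_unit. Qed.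

Lemma qfactS n : qfact n.+1 = qfact n * (1 - q ^+ n.+1).
Proof. by rewrite /qfact qpoch_recr exprS. Qed.

Lemma qfactV0 : qfactV 0 = 0.
Proof. by []. Qed.

(** The rule 1/(q)_{x-1} = (1 - q^x)/(q)_x, which persists at x = 0 because 1 - q^0 = 0. *)
Lemma qfactV_rec x : qfactV x = (1 - q ^+ x) * qfactV x.+1.
Proof.
case: x => [|x]; first by rewrite subrr mul0r.
by rewrite /qfactV qfactS invrM ?qfact_unit ?unit_subX // mulVKr ?unit_subX.
Qed.

Lemma qbaileyV_gt n k : (n < k)%N -> qbaileyV n k = 0.
Proof. by rewrite /qbaileyV -subn_eq0 => /eqP ->; rewrite mul0r. Qed.

Lemma qbaileyVS n k : (k <= n.+1)%N ->
  qbaileyV n k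
  = (1 - q ^+ (n.+1 - k)) * (1 - q ^+ (n.+1 + k)) * qbaileyV n.+1 k.
Proof.
move=> lekn; rewrite /qbaileyV qfactV_rec -subSn //.
by rewrite [qfactV (n + k).+1]qfactV_rec addSn; ring.
Qed.

Lemma qbaileyV_rec n k :
  (1 - q ^+ (2 * n).+1) * (1 - q ^+ (2 * n).+2) * qbaileyV n.+1 k.+1 =
  (1 + q ^+ (2 * n).+1) * qbaileyV n k.+1
  + q ^+ (n - k) * qbaileyV n k + q ^+ (n + k).+2 * qbaileyV n k.+2.
Proof.
rewrite /qbaileyV; have [->|] := eqVneq k n.
  rewrite !subnn !subSnn (_ : n.+1 - n.+2 = 0)%N; last lia.
  rewrite (_ : n.+1 + n.+1 = (2 * n).+2)%N; last lia.
  rewrite (_ : n + n = 2 * n)%N; last lia.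
  rewrite [qfactV (2 * n).+1]qfactV_rec [qfactV (2 * n).+2]qfactV_rec.
  rewrite qfactV0; ring.
case: ltngtP => // [ltkn|ltnk] _.
  have [x ->] : exists x, n = (x + k).+1 by exists (n - k.+1)%N; lia.
  rewrite (_ : ((x + k).+2 - k.+1 = x.+1)%N); last lia.
  rewrite (_ : ((x + k).+3 - k.+1 = x.+2)%N); last lia.
  rewrite (_ : ((x + k).+2 - k = x.+2)%N); last lia.
  rewrite (_ : ((x + k).+2 - k.+2 = x)%N); last lia.
  rewrite (_ : ((x + k).+1 - k = x.+1)%N); last lia.
  set y := ((x + k).+1 + k)%N.
  rewrite (_ : (x + k).+2 + k.+1 = y.+2)%N; last lia.
  rewrite (_ : (x + k).+1 + k.+1 = y.+1)%N; last lia.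
  rewrite (_ : (x + k).+1 + k.+2 = y.+2)%N; last lia.
  rewrite (_ : (2 * (x + k).+1) = x + y.+1)%N; last lia.
  (* All four terms become multiples of 1/((q)_{x+1} (q)_{y+2}); a polynomial identity remains. *)
  rewrite (qfactV_rec x) (qfactV_rec x.+1) (qfactV_rec y.+1) (qfactV_rec y.+2).
  rewrite !exprS exprD !exprS; ring.
rewrite (_ : n.+2 - k.+1 = 0)%N; last lia.
rewrite (_ : n.+1 - k.+1 = 0)%N; last lia.
rewrite (_ : n.+1 - k = 0)%N; last lia.
rewrite (_ : n.+1 - k.+2 = 0)%N; last lia.
by rewrite qfactV0 !mul0r !mulr0 !addr0.
Qed.

(** The previous recurrence centred at 0: by symmetry the neighbours -1 and 1 merge, hence the
    factor 2. *)
Lemma qbaileyV_rec0 n :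
  (1 - q ^+ (2 * n).+1) * (1 - q ^+ (2 * n).+2) * qbaileyV n.+1 0 =
  (1 + q ^+ (2 * n).+1) * qbaileyV n 0 + 2%:R * q ^+ n.+1 * qbaileyV n 1.
Proof.
rewrite /qbaileyV !subn0 !addn0 subn1 addn1.
rewrite [_.+1.-1]/= (qfactV_rec n) (qfactV_rec n.+1).
by rewrite mul2n -addnn !exprS exprD; ring.
Qed.

(** The induction step is the telescoping identity with n = N+1; k > 0 makes the right side vanish
    at N = 0. *)
Lemma qbaileyV_sum N k : (0 < k)%N ->
  (1 - q ^+ k) ^+ 2 * (\sum_(n < N) qfact n ^+ 2 * q ^+ n.+1 * qbaileyV n.+1 k)
  = q ^+ k * (qfact N ^+ 2 * qbaileyV N k).
Proof.
move=> k0; elim: N => [|N IHN].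
  by rewrite big_ord0 qbaileyV_gt // !mulr0.
rewrite big_ord_recr mulrDr IHN qfactS /=.
have [lekN|ltNk] := leqP k N.+1; last first.
  by rewrite !qbaileyV_gt ?(ltnW ltNk) // !mulr0 addr0.
rewrite [qbaileyV N k]qbaileyVS // [(_ + k)%N]addnC exprD.
have -> : q ^+ N.+1 = q ^+ (N.+1 - k) * q ^+ k by rewrite -exprD subnK.
ring.
Qed.

(** Modulo q^(N-k), (q)_N agrees with (q)_{N-k}, and so does (q)_{N+k} with (q)_N. *)
Lemma qbaileyV_lim N k : (k <= N)%N ->
  eqfps (N - k) (qfact N ^+ 2 * qbaileyV N k) 1.
Proof.
move=> lekN; apply: (@eqfps_unit _ _ (qfact (N - k) * qfact (N + k))).
  by rewrite unitrM !qfact_unit.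
have -> : qfact (N - k) * qfact (N + k) * (qfact N ^+ 2 * qbaileyV N k)
        = qfact N * qfact N.
  rewrite /qbaileyV subSn // /qfactV mulrCA [_ * (_ * _^-1)]mulrC -mulrA.
  by rewrite mulrACA !mulVr ?qfact_unit // mulr1 mulr1.
rewrite mulr1 [X in eqfps _ _ X]mulrC.
apply: eqfpsM; first exact/eqfps_sym/(eqfps_le (leq_subr k N))/qpoch_stable.
by have := @qpoch_stable _ q (N - k) k erefl; rewrite subnK.
Qed.

Definition qbailey_term n k : fps R :=
  (-1) ^+ k * q ^+ 'C(k, 2) * qbaileyV n k.

Lemma qbailey_term_gt n k : (n < k)%N -> qbailey_term n k = 0.
Proof. by move=> ltnk; rewrite /qbailey_term qbaileyV_gt // mulr0. Qed.

(** The factors q^(k(k-1)/2) absorb the dependence on k of the coefficients in [qbaileyV_rec], so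
    that the recurrence can be summed over a residue class. *)
Lemma qbailey_term_rec n k :
  (1 - q ^+ (2 * n).+1) * (1 - q ^+ (2 * n).+2) * qbailey_term n.+1 k.+1 =
  (1 + q ^+ (2 * n).+1) * qbailey_term n k.+1
  - q ^+ n * qbailey_term n k - q ^+ n.+1 * qbailey_term n k.+2.
Proof.
rewrite {1}/qbailey_term mulrCA qbaileyV_rec.
have -> : q ^+ n * qbailey_term n k
        = (-1) ^+ k * q ^+ 'C(k.+1, 2) * (q ^+ (n - k) * qbaileyV n k).
  (* For n < k the truncated [n - k] is harmless: both sides vanish. *)
  have [lekn|ltnk] := leqP k n; last first.
    by rewrite qbailey_term_gt // qbaileyV_gt // !mulr0.
  by rewrite binS bin1 exprD -{1}(subnK lekn) exprD /qbailey_term; ring.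
have Ck2 : 'C(k.+2, 2) = ('C(k.+1, 2) + k.+1)%N by rewrite binS bin1.
by rewrite /qbailey_term Ck2 !exprS !exprD !exprS; ring.
Qed.

Lemma qbailey_term_rec0 n :
  (1 - q ^+ (2 * n).+1) * (1 - q ^+ (2 * n).+2) * qbailey_term n.+1 0 =
  (1 + q ^+ (2 * n).+1) * qbailey_term n 0
  - 2%:R * q ^+ n.+1 * qbailey_term n 1.
Proof.
rewrite /qbailey_term !bin_small // !expr0 expr1 mulrCA qbaileyV_rec0; ring.
Qed.

(* The sums over the integers k = 0, 1, 2 mod 3. For k > 0 the summand at -k is
   q^k times [qbailey_term n k]. *)
Definition qbailey_sum0 K n : fps R := qbailey_term n 0
  + \sum_(r < K) (1 + q ^+ (3 * r).+3) * qbailey_term n (3 * r).+3.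
Definition qbailey_sum1 K n : fps R :=
  \sum_(r < K) (qbailey_term n (3 * r).+1
                + q ^+ (3 * r).+2 * qbailey_term n (3 * r).+2).
Definition qbailey_sum2 K n : fps R :=
  \sum_(r < K) (qbailey_term n (3 * r).+2
                + q ^+ (3 * r).+1 * qbailey_term n (3 * r).+1).

(** Since k-1 and k+1 run over the two other classes mod 3, the three sums satisfy a closed system.
    The last summand is the boundary term of the truncation at K; here and in the next two lemmas it
    vanishes for n < 3K. *)
Lemma qbailey_sum0_rec K n :
  (1 - q ^+ (2 * n).+1) * (1 - q ^+ (2 * n).+2) * qbailey_sum0 K n.+1 =
  (1 + q ^+ (2 * n).+1) * qbailey_sum0 K n - q ^+ n * qbailey_sum2 K n
  - q ^+ n.+1 * qbailey_sum1 K n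
  - q ^+ n.+1 * (1 + q ^+ (3 * K)) * qbailey_term n (3 * K).+1.
Proof.
have rec := qbailey_term_rec n; have rec0 := qbailey_term_rec0 n.
rewrite /qbailey_sum0 /qbailey_sum1 /qbailey_sum2.
move: (_ * _) rec rec0 => D rec rec0; elim: K => [|K IHK].
  rewrite !big_ord0 !addr0 !mulr0 rec0 muln0 expr0; ring.
rewrite !big_ord_recr /= addrA mulrDr IHK (mulrCA D) rec.
by rewrite (_ : 3 * K.+1 = (3 * K).+3)%N ?mulnS // !exprS; ring.
Qed.

Lemma qbailey_sum1_rec K n :
  (1 - q ^+ (2 * n).+1) * (1 - q ^+ (2 * n).+2) * qbailey_sum1 K n.+1 =
  (1 + q ^+ (2 * n).+1) * qbailey_sum1 K n - q ^+ n * qbailey_sum0 K n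
  - q ^+ n.+1 * qbailey_sum2 K n + q ^+ n * qbailey_term n (3 * K).
Proof.
have rec := qbailey_term_rec n.
rewrite /qbailey_sum0 /qbailey_sum1 /qbailey_sum2.
move: (_ * _) rec => D rec; elim: K => [|K IHK].
  by rewrite !big_ord0 addr0 !mulr0 muln0; ring.
rewrite !big_ord_recr /= mulrDr IHK [X in _ + X = _]mulrDr rec.
rewrite [D * _]mulrCA rec.
by rewrite (_ : 3 * K.+1 = (3 * K).+3)%N ?mulnS // !exprS; ring.
Qed.

Lemma qbailey_sum2_rec K n :
  (1 - q ^+ (2 * n).+1) * (1 - q ^+ (2 * n).+2) * qbailey_sum2 K n.+1 =
  (1 + q ^+ (2 * n).+1) * qbailey_sum2 K n - q ^+ n * qbailey_sum1 K n
  - q ^+ n.+1 * qbailey_sum0 K n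
  + q ^+ n.+1 * q ^+ (3 * K) * qbailey_term n (3 * K).
Proof.
have rec := qbailey_term_rec n.
rewrite /qbailey_sum0 /qbailey_sum1 /qbailey_sum2.
move: (_ * _) rec => D rec; elim: K => [|K IHK].
  by rewrite !big_ord0 addr0 !mulr0 muln0 expr0; ring.
rewrite !big_ord_recr /= mulrDr IHK [X in _ + X = _]mulrDr rec.
rewrite [D * _]mulrCA rec.
by rewrite (_ : 3 * K.+1 = (3 * K).+3)%N ?mulnS // !exprS; ring.
Qed.

Let p : fps R := q ^+ 3.
Let p0 : fcoef p 0 = 0 := fcoef_pow0 (n := 3) (fcoefX0 R) isT.

(** With x = q^(n+1), the new factor is (1 - x^3)/(1 - x). *)
Lemma qpoch_cube_rec n :
  qpoch p p n.+1 / qfact n.+1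
  = qpoch p p n / qfact n * (1 + q ^+ n.+1 + q ^+ n.+1 ^+ 2).
Proof.
apply: (mulIr (qfact_unit n.+1)); rewrite divrK ?qfact_unit // qpoch_recr.
rewrite -exprS /p exprAC qfactS.
have -> : 1 - q ^+ n.+1 ^+ 3
  = (1 - q ^+ n.+1) * (1 + q ^+ n.+1 + q ^+ n.+1 ^+ 2) by ring.
by rewrite [RHS]mulrACA divrK ?qfact_unit //; ring.
Qed.

(** The recurrences couple the three sums, so their closed forms are proved together, starting at
    index 1 from the values 1, 0, 0 at index 0. As (q)_{2n+2} = (q)_{2n+1} (1-q^(n+1)) (1+q^(n+1)),
    the first one evaluates beta_{n+1}. *)
Lemma qbailey_sums K n : (n < 3 * K)%N ->
  [/\ qfact (2 * n.+1) * qbailey_sum0 K n.+1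
        = (1 + q ^+ n.+1) * (qpoch p p n / qfact n),
      qfact (2 * n.+1) * qbailey_sum1 K n.+1 = - (qpoch p p n / qfact n) &
      qfact (2 * n.+1) * qbailey_sum2 K n.+1
        = - q ^+ n.+1 * (qpoch p p n / qfact n)].
Proof.
have fact2 m : qfact (2 * m.+1)
    = qfact (2 * m) * ((1 - q ^+ (2 * m).+1) * (1 - q ^+ (2 * m).+2)).
  by rewrite mulnS !qfactS mulrA.
pose T0 m := qfact (2 * m) * qbailey_sum0 K m.
pose T1 m := qfact (2 * m) * qbailey_sum1 K m.
pose T2 m := qfact (2 * m) * qbailey_sum2 K m.
have sum_rec m : (m < 3 * K)%N ->
  [/\ T0 m.+1 = (1 + q ^+ (2 * m).+1) * T0 m
        - q ^+ m * T2 m - q ^+ m.+1 * T1 m,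
      T1 m.+1 = (1 + q ^+ (2 * m).+1) * T1 m
        - q ^+ m * T0 m - q ^+ m.+1 * T2 m &
      T2 m.+1 = (1 + q ^+ (2 * m).+1) * T2 m
        - q ^+ m * T1 m - q ^+ m.+1 * T0 m].
  move=> ltmK; rewrite /T0 /T1 /T2 !fact2 -!mulrA !(mulrA (1 - _) (1 - _)).
  rewrite qbailey_sum0_rec qbailey_sum1_rec qbailey_sum2_rec.
  by rewrite !qbailey_term_gt ?ltnS ?(ltnW ltmK) //; split; ring.
have term0 k : (0 < k)%N -> qbailey_term 0 k = 0 by move/qbailey_term_gt.
have qfact0 : qfact 0 = 1 by exact: qpoch0.
have T00 : T0 0%N = 1.
  rewrite /T0 muln0 qfact0 /qbailey_sum0 big1 => [|r _]; last first.
    by rewrite term0 // mulr0.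
  rewrite addr0 /qbailey_term bin_small // !expr0 /qbaileyV /qfactV /= qfact0.
  by rewrite invr1 !mulr1.
have T10 : T1 0%N = 0.
  rewrite /T1 [qbailey_sum1 _ _]big1 ?mulr0 // => r _.
  by rewrite !term0 // mulr0 addr0.
have T20 : T2 0%N = 0.
  rewrite /T2 [qbailey_sum2 _ _]big1 ?mulr0 // => r _.
  by rewrite !term0 // mulr0 addr0.
move=> ltnK; suff : [/\ T0 n.+1 = (1 + q ^+ n.+1) * (qpoch p p n / qfact n),
           T1 n.+1 = - (qpoch p p n / qfact n) &
           T2 n.+1 = - q ^+ n.+1 * (qpoch p p n / qfact n)] by [].
(* The bodies of T0, T1 and T2 make unification diverge. *)
clearbody T0 T1 T2; clear fact2 term0.
elim: n ltnK => [|n IHn] ltnK.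
  have [-> -> ->] := sum_rec 0%N ltnK; rewrite T00 T10 T20 qpoch0 qfact0 divr1.
  by rewrite expr0 muln0; move: (q) => q'; split; ring.
have [-> -> ->] := sum_rec n.+1 ltnK; have [-> -> ->] := IHn (ltnW ltnK).
have e : (2 * n.+1).+1 = (n.+1 + n.+2)%N by lia.
rewrite qpoch_cube_rec e exprD [q ^+ n.+2]exprS; move: (_ / _) => T.
by split; ring.
Qed.

Lemma qfactE n : qfact n = \prod_(1 <= j < n.+1) (1 - q ^+ j).
Proof.
elim: n => [|n IHn]; first by rewrite /qfact /qpoch !big_geq.
by rewrite qfactS IHn [RHS]big_nat_recr.
Qed.

(** The product over j is (q)_{2n+1}/(q)_n, so the left side is q^(n+1) (q)_n^2 beta_{n+1}. *)
Lemma qbailey_summand K n : (n < 3 * K)%N ->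
  q ^+ n.+1 * qpoch p p n /
    ((1 - q ^+ n.+1) * \prod_(n.+1 <= j < 2 * n.+1) (1 - q ^+ j))
  = qfact n ^+ 2 * q ^+ n.+1 * qbailey_sum0 K n.+1.
Proof.
move=> ltnK; set u := \prod_(_ <= j < _) _.
have fact2 : qfact n * u = qfact (2 * n).+1.
  by rewrite !qfactE -big_cat_nat //=; [congr (\prod_(_ <= _ < _) _)|]; lia.
have uU : u \is a GRing.unit.
  by have := qfact_unit (2 * n).+1; rewrite -fact2 unitrM => /andP[].
have n1U : 1 - q ^+ n.+1 \is a GRing.unit by apply: unit_subX.
have n2U : 1 + q ^+ n.+1 \is a GRing.unit.
  by rewrite fps_unitE fcoefD fcoef_pow0 // addr0 unitr1.
apply: (mulIr (_ : (1 - q ^+ n.+1) * u \is a GRing.unit)).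
  by rewrite unitrM n1U.
rewrite divrK ?unitrM ?n1U //; apply: (mulIr n2U).
have [S0 _ _] := qbailey_sums ltnK.
transitivity (q ^+ n.+1 * qfact n * (qfact (2 * n.+1) * qbailey_sum0 K n.+1)).
  rewrite [X in _ = _ * X]S0; move: (qfact_unit n).
  move: (qfact n) (qpoch p p n) => f P fU.
  have -> : P = f * (P / f) by rewrite mulrC divrK.
  by rewrite [f * _ / f]mulrAC divrr // mul1r; ring.
rewrite mulnS qfactS -fact2.
by rewrite (_ : (2 * n).+2 = n.+1 + n.+1)%N ?exprD; [ring|lia].
Qed.

Lemma qbailey_summand0 n : qfact n ^+ 2 * q ^+ n.+1 * qbailey_term n.+1 0
  = q ^+ n.+1 / (1 - q ^+ n.+1) ^+ 2.
Proof.
have U : 1 - q ^+ n.+1 \is a GRing.unit by apply: unit_subX.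
rewrite /qbailey_term bin_small // !expr0 !mul1r /qbaileyV subn0 addn0.
rewrite /qfactV qfactS; move: (qfact n) (qfact_unit n) => f fU.
rewrite -expr2 exprVn exprMn; move: (1 - _) U => u U.
by rewrite invrM ?unitrX // mulrA -[_ * _ / u ^+ 2]mulrA [f ^+ 2 * _]mulrC
           mulrK ?unitrX.
Qed.

(** For k = 3(r+1), the indices k and -k together give the factor 1 + q^k, and the telescoped sum
    tends to q^k/(1-q^k)^2. *)
Lemma qbailey_summandS N r :
  eqfps N
    (\sum_(n < N) qfact n ^+ 2 * q ^+ n.+1
        * ((1 + q ^+ (3 * r).+3) * qbailey_term n.+1 (3 * r).+3))
    (- ((-1) ^+ r * p ^+ (2 * r.+1 + 3 * 'C(r.+1, 2))
        * ((1 + p ^+ r.+1) / (1 - p ^+ r.+1) ^+ 2))).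
Proof.
have [k kE] : exists k, k = (3 * r).+3 by exists (3 * r).+3.
rewrite -!kE; have k0 : (0 < k)%N by rewrite kE.
have pk : p ^+ r.+1 = q ^+ k by rewrite kE -exprM mulnS.
have U : 1 - q ^+ k \is a GRing.unit by apply: unit_subX.
have -> : \sum_(n < N) qfact n ^+ 2 * q ^+ n.+1
      * ((1 + q ^+ k) * qbailey_term n.+1 k)
  = (1 + q ^+ k) * ((-1) ^+ k * q ^+ 'C(k, 2))
    * \sum_(n < N) qfact n ^+ 2 * q ^+ n.+1 * qbaileyV n.+1 k.
  by rewrite mulr_sumr; apply: eq_bigr => n _; rewrite /qbailey_term; ring.
apply: (eqfps_unit (unitrX 2 U)); rewrite mulrCA qbaileyV_sum //.
apply: (@eqfps_trans _ _ ((1 + q ^+ k) * ((-1) ^+ k * q ^+ 'C(k, 2)) * q ^+ k)).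
  rewrite mulrA; case: (leqP k N) => [lekN|ltNk].
    rewrite -!mulrA; do 3!apply: eqfpsMl; rewrite -[X in eqfps _ _ X]mulr1.
    (* The limit is known only modulo q^(N-k); the factor q^k restores the order N. *)
    apply: (@eqfps_le _ _ (N - k + k)); first by rewrite subnK.
    by apply: eqfps_pow_shift => //; rewrite mulrA; apply: qbaileyV_lim.
  rewrite qbaileyV_gt // !mulr0; apply: eqfps_sym; rewrite mulrC.
  by apply: eqfps_pow0 => //; apply: ltnW.
apply: eq_eqfps; rewrite pk [RHS]mulrN [in RHS](mulrCA (_ ^+ 2)).
rewrite [(1 - q ^+ k) ^+ 2 * (_ / _)]mulrC divrK ?unitrX //.
(* Both exponents of q equal k(k+1)/2 = 3(r+1)(3r+4)/2. *)
have -> : p ^+ (2 * r.+1 + 3 * 'C(r.+1, 2)) = q ^+ ('C(k, 2) + k).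
  rewrite -exprM; congr (_ ^+ _).
  have := mul_bin_diag k 1; have := mul_bin_diag r.+1 1.
  by rewrite !bin1 kE /=; lia.
have -> : (-1) ^+ k = - (-1) ^+ r :> fps R.
  by rewrite -signr_odd kE /= oddM /= !negbK signrN signr_odd.
by rewrite exprD; ring.
Qed.

Lemma cubic_bailey_sum N :
  eqfps N
    (\sum_(n < N) q ^+ n.+1 * qpoch p p n /
       ((1 - q ^+ n.+1) * \prod_(n.+1 <= j < 2 * n.+1) (1 - q ^+ j)))
    (\sum_(n < N) q ^+ n.+1 / (1 - q ^+ n.+1) ^+ 2
     - \sum_(r < N) (-1) ^+ r * p ^+ (2 * r.+1 + 3 * 'C(r.+1, 2))
         * ((1 + p ^+ r.+1) / (1 - p ^+ r.+1) ^+ 2)).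
Proof.
rewrite -sumrN; apply: (@eqfps_trans _ _
 (\sum_(n < N) q ^+ n.+1 / (1 - q ^+ n.+1) ^+ 2
  + \sum_(r < N) \sum_(n < N) qfact n ^+ 2 * q ^+ n.+1
      * ((1 + q ^+ (3 * r).+3) * qbailey_term n.+1 (3 * r).+3))); last first.
  by apply: eqfpsD => //; apply: eqfps_sum => r _; apply: qbailey_summandS.
apply: eq_eqfps; rewrite exchange_big -big_split /=; apply: eq_bigr => n _.
(* Truncating the sum over k at K = N loses nothing, as n < N <= 3N. *)
have ltnK : (n < 3 * N)%N by rewrite (leq_trans (ltn_ord n)) // leq_pmull.
rewrite [LHS](qbailey_summand ltnK) -qbailey_summand0 -mulr_sumr.
exact: mulrDr.
Qed.

End CubicBaileyPair.

(** * Two forms of the Lambert series *)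

Section LambertSeries.
Variable R : comUnitRingType.
Implicit Types N m n : nat.

Let q : fps R := fpsX.

(** Both sides expand into the double sum of m q^(nm), summed over m first on the left and over n
    first on the right. *)
Lemma lambert_linear N :
  eqfps N (\sum_(n < N) q ^+ n.+1 / (1 - q ^+ n.+1) ^+ 2)
    (\sum_(n < N) n.+1%:R * q ^+ n.+1 / (1 - q ^+ n.+1)).
Proof.
have geom (x : fps R) : (1 - x) * (\sum_(m < N) x ^+ m.+1) = x - x ^+ N.+1.
  elim: (N) => [|M IHM]; first by rewrite big_ord0; ring.
  by rewrite big_ord_recr /= mulrDr IHM !exprS; ring.
have geom' (x : fps R) : (1 - x) ^+ 2 * (\sum_(m < N) m.+1%:R * x ^+ m.+1)
    = x - x ^+ N.+1 * (N.+1%:R - N%:R * x).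
  elim: (N) => [|M IHM]; first by rewrite big_ord0; ring.
  rewrite big_ord_recr /= mulrDr IHM -[M.+2]addn1 -[M.+1]addn1.
  by rewrite !natrD !exprD; ring.
have U n : 1 - q ^+ n.+1 \is a GRing.unit by apply: unit_subX.
have pow0 n (f : fps R) : eqfps N ((q ^+ n.+1) ^+ N.+1 * f) 0.
  by rewrite -exprM; apply: eqfps_pow0 => //; nia.
apply: (@eqfps_trans _ _
  (\sum_(n < N) \sum_(m < N) m.+1%:R * (q ^+ n.+1) ^+ m.+1)).
  apply: eqfps_sum => n _; apply: (eqfps_unit (unitrX 2 (U n))).
  rewrite geom' mulrC divrK ?unitrX // -[X in eqfps _ X]subr0.
  by apply: eqfpsB => //; apply/eqfps_sym.
rewrite exchange_big /=; apply: eqfps_sum => m _.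
rewrite -mulr_sumr -mulrA; apply: eqfpsMl.
have -> : \sum_(n < N) (q ^+ n.+1) ^+ m.+1 = \sum_(n < N) (q ^+ m.+1) ^+ n.+1.
  by apply: eq_bigr => n _; rewrite exprAC.
apply: (eqfps_unit (U m)); rewrite geom [X in eqfps _ _ X]mulrC divrK //.
rewrite -[X in eqfps _ _ X]subr0; apply: eqfpsB => //.
by rewrite -[_ ^+ N.+1]mulr1.
Qed.
End LambertSeries.

(** * Partitions and the second rank moment *)

(** The partitions with exactly b parts, all at most a. Either a is taken as the largest part,
    lowering b, or a is lowered; the nested fixpoint makes this recursion structural. *)
Fixpoint parts_seq (a b : nat) : seq (seq nat) :=
  match b with
  | 0 => [:: [::]]
  | b'.+1 => (fix loop a := if a is a'.+1
              then map (cons a) (parts_seq a b') ++ loop a' else [::]) a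
  end.

Lemma parts_seqSS a b :
  parts_seq a.+1 b.+1 = map (cons a.+1) (parts_seq a.+1 b) ++ parts_seq a b.+1.
Proof. by []. Qed.

Lemma mem_parts_seq a b s : (s \in parts_seq a b) =
  [&& sorted geq s, 0%N \notin s, all (geq a) s & size s == b].
Proof.
elim: b a s => [|b IHb]; first by move=> a [|x s] //=; rewrite inE /= !andbF.
elim=> [|a IHa] s.
  by case: s => [|[|x] s] //=; rewrite ?inE /= ?andbF.
rewrite parts_seqSS mem_cat IHa; apply/orP/and4P.
  case=> [/mapP[t]|/and4P[s_sorted s_pos s_le ->]].
    rewrite IHb => /and4P[t_sorted t_pos t_le /eqP <-] ->; split=> //=.
      by rewrite (path_sortedE (rev_trans leq_trans)) t_le.
      by rewrite leqnn.
  split=> //; apply: sub_all s_le => x /=; exact: leqW.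
case: s => [|x s] [] //= s_sorted; rewrite inE negb_or => /andP[x_pos s_pos].
case/andP; rewrite leq_eqVlt => /predU1P[->|ltxa] s_le s_size.
  left; apply/map_f; rewrite IHb (path_sorted s_sorted) s_pos s_le /=.
  by rewrite -eqSS.
have lexa : (x <= a)%N by rewrite -ltnS.
right; rewrite s_sorted x_pos s_pos s_size lexa /= andbT.
move: s_sorted; rewrite (path_sortedE (rev_trans leq_trans)) => /andP[s_lex _].
by apply: sub_all s_lex => y /= leyx; apply: leq_trans leyx lexa.
Qed.

Lemma parts_seq_uniq a b : uniq (parts_seq a b).
Proof.
elim: b a => [|b IHb] //; elim=> [|a IHa] //.
rewrite parts_seqSS cat_uniq IHa andbT map_inj_uniq ?IHb => [|s t [] //].
apply/hasPn => s; rewrite mem_parts_seq => /and4P[_ _ s_le _].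
by apply/negP => /mapP[t _ st]; move: s_le; rewrite st /= ltnn.
Qed.

Lemma rank_moment2E n : rank_moment2 n
  = \sum_(s : n.-bseq 'I_n.+1 | is_partition n (map val s))
      rank (map val s) ^+ 2.
Proof.
(* Ranks outside this list are attained by no partition of n, so the sum over all integers reduces
   to it. *)
pose r := undup [seq rank (map val s) | s : n.-bseq 'I_n.+1].
rewrite /rank_moment2 (@fsbigE _ _ _ _ _ r) ?undup_uniq //; last first.
  move=> m _ mr; suff -> : rank_count m n = 0%N by rewrite mulr0.
  apply/eqP; rewrite cards_eq0; apply/set0Pn => -[s].
  rewrite inE => /andP[_ /eqP sm]; move/negP: mr; apply.
  by rewrite mem_undup -sm; apply: map_f; rewrite mem_enum.
under eq_bigr => m _.
  rewrite /rank_count -sum1_card -natz natr_sum /= mulr_sumr.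
  under eq_bigl do rewrite inE.
  rewrite big_mkcondr /=.
  over.
rewrite (eq_bigl predT) => [|m]; last by rewrite classical_sets.in_setT.
rewrite exchange_big /=; apply: eq_bigr => s _.
rewrite -big_mkcond /= -big_filter.
have rs : rank (map val s) \in r.
  by rewrite mem_undup; apply: map_f; rewrite mem_enum.
rewrite (eq_filter (a2 := pred1 (rank (map val s)))) => [|m]; last first.
  exact: eq_sym.
by rewrite filter_pred1_uniq ?undup_uniq // big_seq1 mulr1.
Qed.

(** Sorts the partitions by largest part i+1 and number j of other parts; n > 0 excludes the empty
    partition. *)
Lemma partition_sum (V : nmodType) (F : seq nat -> V) n N :
  (0 < n <= N)%N ->
  \sum_(s : n.-bseq 'I_n.+1 | is_partition n (map val s)) F (map val s)
  = \sum_(0 <= i < N) \sum_(0 <= j < N)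
      \sum_(s <- parts_seq i.+1 j | (i.+1 + sumn s)%N == n) F (i.+1 :: s).
Proof.
case/andP=> n0 lenN.
pose L := [seq i.+1 :: s | i <- iota 0 N,
             s <- [seq s <- flatten [seq parts_seq i.+1 j | j <- iota 0 N]
                  | (i.+1 + sumn s)%N == n]].
transitivity (\sum_(s <- L) F s); last first.
  rewrite /L big_allpairs_dep /index_iota subn0; apply: eq_bigr => i _.
  by rewrite big_filter big_flatten big_map.
rewrite -big_filter -(big_map (fun s : n.-bseq 'I_n.+1 => map val s) xpredT F).
apply: perm_big; apply: uniq_perm.
- rewrite map_inj_uniq ?filter_uniq ?index_enum_uniq //.
  by move=> s t /(inj_map val_inj)/val_inj.
- rewrite allpairs_uniq_dep ?iota_uniq // => [i _|[i s] [j t] _ _ [-> ->] //].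
  rewrite filter_uniq //; elim: (iota 0 N) (iota_uniq 0 N) => //= j l IHl.
  case/andP=> jl /IHl l_uniq; rewrite cat_uniq parts_seq_uniq l_uniq andbT /=.
  apply/hasPn => s /flatten_mapP[j' j'l]; rewrite !mem_parts_seq.
  case/and4P=> _ _ _ /eqP sj'; apply/negP => /and4P[_ _ _ /eqP sj].
  by rewrite -sj sj' j'l in jl.
move=> s; apply/mapP/allpairsPdep => [[t]|[i [t [i_n]]]].
  rewrite mem_filter => /andP[t_part _] ->; have := size_bseq t.
  rewrite -(size_map val); case/and3P: t_part; move: (map val t) => {}t.
  case: t => [|[|i] t] //=.
    by move=> _ _ /eqP n_eq0; rewrite -n_eq0 in n0.
  move=> t_sorted; rewrite inE /= => t_pos t_n ltn_size.
  have /andP[t_le t_sort] : all (geq i.+1) t && sorted geq t.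
    by rewrite -(path_sortedE (rev_trans leq_trans)).
  exists i, t; split=> //; first by rewrite mem_iota; lia.
  rewrite mem_filter t_n /=; apply/flatten_mapP; exists (size t).
    by rewrite mem_iota; lia.
  by rewrite mem_parts_seq t_sort t_pos t_le /=.
rewrite mem_filter => /andP[t_n /flatten_mapP[j j_n]].
rewrite mem_parts_seq => /and4P[t_sorted t_pos t_le t_size] ->.
have t_part : is_partition n (i.+1 :: t).
  rewrite /is_partition /= t_n andbT inE negb_or t_pos.
  by rewrite (path_sortedE (rev_trans leq_trans)) t_le t_sorted.
have [u ut] := partition_bseq t_part.
by exists u; rewrite // mem_filter mem_index_enum andbT ut.
Qed.

Lemma rank_parts_seq i j s : s \in parts_seq i.+1 j ->
  rank (i.+1 :: s) = i%:Z - j%:Z.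
Proof.
rewrite mem_parts_seq => /and4P[_ _ s_le /eqP <-]; rewrite /rank big_cons.
suff /maxn_idPl -> : (\max_(x <- s) x <= i.+1)%N by rewrite /=; lia.
  elim: s s_le => [|x s IHs] /=; first by rewrite big_nil.
  by case/andP=> lexi /IHs; rewrite big_cons geq_max lexi.
Qed.

(** * Gaussian binomials and rank generating functions *)

Section RankMoment.
Variable R : comUnitRingType.
Implicit Types (N a b i j k m n : nat).
Variable p : fps R.
Hypothesis p0 : fcoef p 0 = 0.

(** The Gaussian binomial coefficient, which counts partitions inside an a by b box. *)
Definition gbin a b : fps R := qpoch p p (a + b) / (qpoch p p a * qpoch p p b).

Lemma gbinC a b : gbin a b = gbin b a.
Proof. by rewrite /gbin addnC [_ * qpoch _ _ b]mulrC. Qed.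

Lemma gbin0 b : gbin 0 b = 1.
Proof. by rewrite /gbin qpoch0 mul1r divrr ?qpoch_unit. Qed.

(** A q-Pascal rule, from 1 - p^(a+b+2) = (1 - p^(a+1)) + p^(a+1) (1 - p^(b+1)). *)
Lemma gbinSS a b :
  gbin a.+1 b.+1 = gbin a b.+1 + p ^+ a.+1 * gbin a.+1 b.
Proof.
have U := qpoch_unit _ p0.
have gbinE m n : gbin m n * (qpoch p p m * qpoch p p n) = qpoch p p (m + n).
  by rewrite divrK // unitrM !U.
apply: (mulIr (_ : qpoch p p a.+1 * qpoch p p b.+1 \is a GRing.unit)).
  by rewrite unitrM !U.
transitivity (gbin a b.+1 * (qpoch p p a * qpoch p p b.+1) * (1 - p ^+ a.+1)
  + p ^+ a.+1
    * (gbin a.+1 b * (qpoch p p a.+1 * qpoch p p b) * (1 - p ^+ b.+1))).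
  rewrite !gbinE !addSn !addnS [LHS]qpoch_recr -exprS -addSn -addnS exprD; ring.
by rewrite 2!(qpoch_recr p p) -!exprS; ring.
Qed.

Lemma gbinSS' a b :
  gbin a.+1 b.+1 = gbin a.+1 b + p ^+ b.+1 * gbin a b.+1.
Proof. by rewrite gbinC gbinSS gbinC [gbin _ a]gbinC. Qed.

(** Partitions in an (a+1) by b box, sorted by their number j of parts. *)
Lemma gbin_sum a b : \sum_(j < b.+1) p ^+ j * gbin a j = gbin a.+1 b.
Proof.
elim: b => [|b IHb].
  by rewrite big_ord1 expr0 mul1r /= [LHS]gbinC [RHS]gbinC !gbin0.
by rewrite big_ord_recr /= IHb -gbinSS'.
Qed.

(** Subtracting 1 from each of the b parts leaves a partition in an a by b box. The induction
    follows [parts_seq], matched by [gbinSS]. *)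
Lemma gbin_parts a b :
  \sum_(s <- parts_seq a.+1 b) p ^+ sumn s = p ^+ b * gbin a b.
Proof.
elim: b a => [|b IHb] a; first by rewrite big_seq1 gbinC gbin0 mulr1.
elim: a => [|a IHa]; rewrite parts_seqSS big_cat big_map /=.
  rewrite big_nil addr0; under eq_bigr do rewrite addSn add0n exprS.
  by rewrite -mulr_sumr IHb !gbin0 exprS !mulr1.
under eq_bigr do rewrite exprD.
rewrite -mulr_sumr IHb IHa gbinSS !exprS; ring.
Qed.

(** The (i, j) term collects the partitions with largest part i+1 and j+1 parts, whose rank is i -
    j. *)
Lemma rank_moment2_gf N :
  eqfps N.+1 (\sum_(1 <= n < N.+1) (rank_moment2 n)%:~R * p ^+ n)
    (\sum_(i < N) \sum_(j < N)
       (i%:R - j%:R) ^+ 2 * (p ^+ (i + j).+1 * gbin i j)).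
Proof.
pose wt i j (s : seq nat) n : fps R := if (i.+1 + sumn s == n)%N
   then (i%:R - j%:R) ^+ 2 * p ^+ (i + sumn s).+1 else 0.
have -> : \sum_(1 <= n < N.+1) (rank_moment2 n)%:~R * p ^+ n
  = \sum_(i < N) \sum_(j < N) \sum_(s <- parts_seq i.+1 j)
      \sum_(1 <= n < N.+1) wt i j s n.
  transitivity (\sum_(1 <= n < N.+1) \sum_(i < N) \sum_(j < N)
                   \sum_(s <- parts_seq i.+1 j) wt i j s n).
    apply: eq_big_nat => n n_N.
    rewrite rank_moment2E (partition_sum (fun s => rank s ^+ 2) n_N).
    rewrite rmorph_sum mulr_suml big_mkord; apply: eq_bigr => i _.
    rewrite rmorph_sum mulr_suml big_mkord; apply: eq_bigr => j _.
    rewrite rmorph_sum mulr_suml big_mkcond big_seq [RHS]big_seq.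
    apply: eq_bigr => s /rank_parts_seq ->; rewrite /wt.
    by case: eqP => // <-; rewrite rmorphXn rmorphB.
  rewrite exchange_big; apply: eq_bigr => i _.
  rewrite exchange_big; apply: eq_bigr => j _.
  by rewrite exchange_big.
apply: eqfps_sum => i _; apply: eqfps_sum => j _.
have -> : p ^+ (i + j).+1 * gbin i j
    = \sum_(s <- parts_seq i.+1 j) p ^+ (i + sumn s).+1.
  rewrite -addSn exprD -mulrA -gbin_parts mulr_sumr.
  by under eq_bigr do rewrite -exprD.
rewrite mulr_sumr; apply: eqfps_sum => s _.
have [leN|ltN] := leqP (i.+1 + sumn s) N.
  rewrite (bigD1_seq (i.+1 + sumn s)%N) ?iota_uniq ?mem_index_iota //=.
  rewrite /wt eqxx big1 ?addr0 // => n /negbTE nE.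
  by rewrite eq_sym nE.
(* A partition of a number above N is absent on the left and has weight divisible by p^(N+1) on the
   right. *)
rewrite big_nat big1 => [|n n_N]; last by rewrite /wt ifN //; lia.
by rewrite mulrC; apply/eqfps_sym/eqfps_pow0.
Qed.

(* The generating function of the partitions with rank at least m and largest
   part at most N; the l-th summand counts those with largest part l+m+1. *)
Definition rank_tail N m : fps R :=
  \sum_(l < N - m) p ^+ (l + m).+1 * gbin (l + m).+1 l.

(** (n-j)^2 is the sum of the first n-j odd numbers; the sums are then exchanged. *)
Lemma odd_weighted_sum (V : comNzRingType) n (f : nat -> V) :
  \sum_(j < n) (n%:R - j%:R) ^+ 2 * f j
  = \sum_(m < n) (2 * m).+1%:R * \sum_(j < n - m) f j.
Proof.
have widen m : \sum_(j < n - m) f j = \sum_(j < n | (j < n - m)%N) f j.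
  by rewrite (big_ord_widen n) // leq_subr.
under [RHS]eq_bigr do rewrite widen mulr_sumr.
rewrite (exchange_big_dep predT) //=; apply: eq_bigr => j _.
rewrite -mulr_suml; congr (_ * _).
rewrite (eq_bigl (fun m : 'I_n => (m < n - j)%N)) => [|m]; last by lia.
rewrite -(big_ord_widen n (fun m => (2 * m).+1%:R)) ?leq_subr //.
rewrite -natrB ?(ltnW (ltn_ord j)) //.
elim: (n - j)%N => [|d IHd]; first by rewrite big_ord0 expr0n.
by rewrite big_ord_recr /= -IHd -!natrX -natrD; congr (_%:R); lia.
Qed.

(** Going from N to N+1 adds a row and a column, equal by the symmetry of the rank, and a zero
    corner. By [odd_weighted_sum] and [gbin_sum], the row supplies the last summand of each tail. *)
Lemma rank_tail_sum N :
  \sum_(i < N) \sum_(j < N) (i%:R - j%:R) ^+ 2 * (p ^+ (i + j).+1 * gbin i j)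
  = 2%:R * \sum_(m < N) (2 * m).+1%:R * rank_tail N m.+1.
Proof.
pose F i j : fps R := (i%:R - j%:R) ^+ 2 * (p ^+ (i + j).+1 * gbin i j).
rewrite -[LHS]/(\sum_(i < N) \sum_(j < N) F i j).
elim: N => [|N IHN]; first by rewrite !big_ord0 mulr0.
have FC i j : F i j = F j i by rewrite /F addnC gbinC -sqrrN opprB.
rewrite big_ord_recr /=; under eq_bigr do rewrite big_ord_recr /=.
rewrite big_split /= IHN big_ord_recr /=.
have -> : F N N = 0 by rewrite /F subrr expr0n mul0r.
have -> : \sum_(i < N) F i N = \sum_(j < N) F N j by apply: eq_bigr.
have -> : \sum_(j < N) F N j
    = \sum_(m < N) (2 * m).+1%:R * (p ^+ N.+1 * gbin N.+1 (N - m.+1)).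
  transitivity (\sum_(j < N)
    (N%:R - j%:R) ^+ 2 * (p ^+ N.+1 * (p ^+ j * gbin N j))).
    by apply: eq_bigr => j _; rewrite /F mulrA -exprD.
  rewrite (odd_weighted_sum _ (fun j => p ^+ N.+1 * (p ^+ j * gbin N j))).
  by apply: eq_bigr => m _; rewrite -mulr_sumr -gbin_sum subnSK.
rewrite [in RHS]big_ord_recr /= [rank_tail _ N.+1]/rank_tail subnn big_ord0.
rewrite mulr0 !addr0 -addrA -mulr2n -[X in _ + X]mulr_natl -mulrDr -big_split.
rewrite /=; congr (_ * _).
apply: eq_bigr => m _; rewrite -mulrDr; congr (_ * _).
rewrite /rank_tail subSn // big_ord_recr /=.
by rewrite (_ : (N - m.+1 + m.+1)%N = N) ?subnK.
Qed.

Lemma gbin_lim a b : (b <= a)%N -> eqfps b (qpoch_inf p p * gbin a b) 1.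
Proof.
move=> leba; apply: (@eqfps_unit _ _ (qpoch p p a * qpoch p p b)).
  by rewrite unitrM !qpoch_unit.
rewrite mulr1 /gbin mulrC -mulrA divrK ?unitrM ?qpoch_unit //.
apply: eqfpsM; first exact: qpoch_infE.
by rewrite addnC; apply: qpoch_stable.
Qed.

(* Partitions in an (L+m+3) x (L+1) box split by rank: rank at most m+2, by
   number of parts, and rank at least m+3, by largest part. *)
Lemma gbin_rank_split m L : gbin (L + m).+3 L.+1
  = \sum_(l < L.+2) p ^+ l * gbin (l + m).+1 l
    + \sum_(l < L) p ^+ (l + m.+3).+1 * gbin (l + m.+3).+1 l.
Proof.
elim: L => [|L IHL].
  rewrite big_ord0 addr0 2!big_ord_recr big_ord0 /= add0r gbinSS'.
  by rewrite ![gbin _ 0]gbinC !gbin0 expr0 mulr1.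
rewrite big_ord_recr [X in _ = _ + X]big_ord_recr /= addrACA -IHL.
by rewrite gbinSS' addSn gbinSS !addnS !addSn -addrA [X in _ + X]addrC.
Qed.

(** Obtained from [gbin_rank_split] times p^(m+1), the full box tending to 1/(p)_oo. *)
Lemma rank_tail_rec N m :
  eqfps N (qpoch_inf p p * rank_tail N m)
    (p ^+ m.+1 * (1 - qpoch_inf p p * rank_tail N m.+3)).
Proof.
have tailE n : rank_tail N n
    = p ^+ n.+1 * \sum_(l < N - n) p ^+ l * gbin (l + n).+1 l.
  rewrite /rank_tail mulr_sumr; apply: eq_bigr => l _.
  by rewrite mulrA -exprD addSn addnC.
have [leNm|ltmN] := leqP N m.+1.
  apply: (@eqfps_trans _ _ 0); last exact/eqfps_sym/eqfps_pow0.
  by rewrite tailE mulrCA; apply: eqfps_pow0.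
(* With this L, the first sum of [gbin_rank_split] times p^(m+1) is exactly [rank_tail N m]. *)
have [L NmL] : exists L, (N - m = L.+2)%N by exists (N - m).-2; lia.
have tail3 : rank_tail N m.+3
    = \sum_(l < L.-1) p ^+ (l + m.+3).+1 * gbin (l + m.+3).+1 l.
  by rewrite /rank_tail (_ : N - m.+3 = L.-1)%N //; lia.
have split_tail : p ^+ m.+1 * (qpoch_inf p p * gbin (L + m).+3 L.+1)
  = qpoch_inf p p * rank_tail N m + p ^+ m.+1 * (qpoch_inf p p *
      \sum_(l < L) p ^+ (l + m.+3).+1 * gbin (l + m.+3).+1 l).
  by rewrite gbin_rank_split tailE NmL; ring.
(* The box sum has at most one term more than [rank_tail N m.+3]; times p^(m+1), that term is
   divisible by p^N. *)
have tail3' : eqfps N (p ^+ m.+1 * (qpoch_inf p p *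
      \sum_(l < L) p ^+ (l + m.+3).+1 * gbin (l + m.+3).+1 l))
    (p ^+ m.+1 * (qpoch_inf p p * rank_tail N m.+3)).
  rewrite tail3; case: (L) NmL => // L' NmL.
  rewrite big_ord_recr /= !mulrDr -[X in eqfps _ _ X]addr0; apply: eqfpsD => //.
  rewrite mulrCA [qpoch_inf _ _ * _]mulrC -!mulrA mulrA -exprD.
  by apply: eqfps_pow0 => //; lia.
rewrite -[_ * rank_tail N m](addrK (p ^+ m.+1 * (qpoch_inf p p *
      \sum_(l < L) p ^+ (l + m.+3).+1 * gbin (l + m.+3).+1 l))) -split_tail.
rewrite mulrBr mulr1; apply: eqfpsB => //.
rewrite -[X in eqfps _ _ X]mulr1 (_ : N = L.+1 + m.+1)%N; last by lia.
by apply: eqfps_pow_shift => //; apply: gbin_lim; lia.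
Qed.

(** Iterating the recurrence accumulates the exponents m+1, m+4, m+7, and so on; after N iterations
    the remaining tail is empty. *)
Lemma rank_tail_pentagonal N m :
  eqfps N (qpoch_inf p p * rank_tail N m)
    (\sum_(k < N) (-1) ^+ k * p ^+ (k.+1 * m.+1 + 3 * 'C(k.+1, 2))).
Proof.
have iter K : eqfps N (qpoch_inf p p * rank_tail N m)
    (\sum_(k < K) (-1) ^+ k * p ^+ (k.+1 * m.+1 + 3 * 'C(k.+1, 2))
     + (-1) ^+ K * p ^+ (K * m.+1 + 3 * 'C(K, 2))
       * (qpoch_inf p p * rank_tail N (m + 3 * K))).
  elim: K => [|K IHK].
    by rewrite big_ord0 add0r !mul1r muln0 addn0; apply: eq_eqfps.
  apply: (eqfps_trans IHK); rewrite big_ord_recr /= -addrA; apply: eqfpsD => //.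
  apply: eqfps_trans; first by apply/eqfpsMl/rank_tail_rec.
  rewrite (_ : (m + 3 * K).+3 = m + 3 * K.+1)%N; last by lia.
  have -> : (K.+1 * m.+1 + 3 * 'C(K.+1, 2)
             = (K * m.+1 + 3 * 'C(K, 2)) + (m + 3 * K).+1)%N.
    by rewrite binS bin1; lia.
  apply: eq_eqfps; move: (K * _ + _)%N (_ + _).+1 => a b.
  by rewrite exprD exprS; ring.
apply: (eqfps_trans (iter N)).
rewrite [rank_tail _ (_ + _)]/rank_tail.
rewrite (_ : N - (m + 3 * N) = 0)%N; last by lia.
by rewrite big_ord0 !mulr0 addr0; apply: eq_eqfps.
Qed.

Lemma odd_geometric_sum (x : fps R) N :
  (1 - x) ^+ 2 * (\sum_(m < N) (2 * m).+1%:R * x ^+ m.+1)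
  = x * (1 + x) - x ^+ N.+1 * ((2 * N).+1%:R + x - (2 * N)%:R * x).
Proof.
elim: N => [|N IHN]; first by rewrite big_ord0 muln0; ring.
rewrite big_ord_recr /= mulrDr IHN mulnS -[(2 * N).+1]addn1 -[(2 + _).+1]addn1.
by rewrite !natrD !exprS; ring.
Qed.

(** The pentagonal expansions of the tails are summed over m first, by [odd_geometric_sum]. The
    result is twice the sum over r in [cubic_bailey_sum]. *)
Lemma rank_moment2_pentagonal N :
  eqfps N
    (qpoch_inf p p * \sum_(1 <= n < N.+1) (rank_moment2 n)%:~R * p ^+ n)
    (2%:R * \sum_(k < N) (-1) ^+ k * p ^+ (2 * k.+1 + 3 * 'C(k.+1, 2))
       * ((1 + p ^+ k.+1) / (1 - p ^+ k.+1) ^+ 2)).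
Proof.
apply: eqfps_trans.
  by apply/eqfpsMl/(eqfps_le (leqnSn N))/rank_moment2_gf.
rewrite rank_tail_sum mulrCA; apply: eqfpsMl; rewrite mulr_sumr.
apply: eqfps_trans.
  apply: eqfps_sum => m _; rewrite mulrCA.
  by apply/eqfpsMl/rank_tail_pentagonal.
under eq_bigr do rewrite mulr_sumr.
rewrite exchange_big /=; apply: eqfps_sum => k _.
set x := p ^+ k.+1; have xU : 1 - x \is a GRing.unit by apply: unit_subX.
have -> : \sum_(m < N) (2 * m).+1%:R
    * ((-1) ^+ k * p ^+ (k.+1 * m.+2 + 3 * 'C(k.+1, 2)))
  = (-1) ^+ k * p ^+ (3 * 'C(k.+1, 2)) * x
    * \sum_(m < N) (2 * m).+1%:R * x ^+ m.+1.
  rewrite mulr_sumr; apply: eq_bigr => m _.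
  by rewrite exprD mulnS exprD -exprM -/x; ring.
apply: (eqfps_unit (unitrX 2 xU)); rewrite mulrCA odd_geometric_sum.
rewrite mulrBr -[X in eqfps _ _ X]subr0; apply: eqfpsB.
  apply: eq_eqfps; rewrite exprD mul2n -addnn exprD -/x.
  by rewrite [RHS]mulrCA [(1 - x) ^+ 2 * _]mulrC divrK ?unitrX //; ring.
rewrite mulrCA -exprM; apply: eqfps_pow0 => //; nia.
Qed.

End RankMoment.

(** * Comparison of both sides after clearing (q^3; q^3)_oo *)

Theorem theorem1 (R : numFieldType) :
  let q : fps R := fpsX in
  fps_sum 1 (fun n =>
    q ^+ n / ((1 - q ^+ n) * (\prod_(n <= j < 2 * n) (1 - q ^+ j))
              * qpoch_inf (q ^+ (3 * n)) (q ^+ 3)))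
  = (qpoch_inf (q ^+ 3) (q ^+ 3))^-1
      * fps_sum 1 (fun n => n%:R * q ^+ n / (1 - q ^+ n))
    - 2%:R^-1 * fps_sum 1 (fun n => (rank_moment2 n)%:~R * q ^+ (3 * n)).
Proof.
move=> q; set p := q ^+ 3.
have p0 : fcoef p 0 = 0 by exact: (@fcoef_pow0 _ _ 3).
have pE n : q ^+ (3 * n) = p ^+ n by rewrite exprM.
have PU : qpoch_inf p p \is a GRing.unit by exact: (@qpoch_inf_unit _ p 0).
have sum_shift M (F : nat -> fps R) :
    \sum_(n < M) F n.+1 = \sum_(1 <= n < M.+1) F n.
  by rewrite big_add1 big_mkord.
have sum_trunc M (F G : nat -> fps R) : (forall n, F n = q ^+ n * G n) ->
    eqfps M (fps_sum 1 F) (\sum_(n < M) F n.+1).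
  move=> FG; rewrite sum_shift; apply: (eqfps_le (leqnSn M)).
  by apply: fps_sumE => n _; exists (G n).
apply: (mulrI PU); apply: eqfps0 => N.
apply: (@eqfps_trans _ _ (\sum_(n < N) q ^+ n.+1 / (1 - q ^+ n.+1) ^+ 2
  - \sum_(r < N) (-1) ^+ r * p ^+ (2 * r.+1 + 3 * 'C(r.+1, 2))
      * ((1 + p ^+ r.+1) / (1 - p ^+ r.+1) ^+ 2))).
  apply: eqfps_trans; last exact: cubic_bailey_sum.
  apply: eqfps_trans; first apply: eqfpsMl.
    by apply: (sum_trunc _ _ (fun n =>
      ((1 - q ^+ n) * (\prod_(n <= j < 2 * n) (1 - q ^+ j))
       * qpoch_inf (q ^+ (3 * n)) p)^-1)).
  rewrite mulr_sumr; apply: eq_eqfps; apply: eq_bigr => n _.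
  (* Splitting (p)_oo after n factors cancels the infinite product of the summand and leaves
     (p)_n. *)
  rewrite pE (qpoch_inf_split p n p0) -exprS.
  have QU := qpoch_inf_unit n p0; move: (qpoch_inf _ _) QU => Q QU.
  have uU : (1 - q ^+ n.+1) * \prod_(n.+1 <= j < 2 * n.+1) (1 - q ^+ j)
      \is a GRing.unit.
    rewrite unitrM unit_subX //= big_nat; apply: rpred_prod => j /andP[jn _].
    by apply: unit_subX => //; lia.
  move: (_ * \prod_(_ <= _ < _) _) uU => u uU.
  rewrite invrM // -mulrA mulrCA !mulrA; congr (_ / u).
  by rewrite -(mulrA Q) [Q * _]mulrC mulrK // mulrC.
rewrite mulrBr mulVKr //; apply: eqfpsB.
  apply: eqfps_trans; [exact: lambert_linear|apply: eqfps_sym].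
  apply: (sum_trunc _ _ (fun n => n%:R / (1 - q ^+ n))) => n.
  by rewrite -mulrA mulrCA.
have U2 : (2%:R : fps R) \is a GRing.unit.
  by rewrite fps_unitE -[2%:R]/(1 + 1) fcoefD unitfE -[1 + 1]/(2%:R) pnatr_eq0.
apply: (eqfps_unit U2); rewrite [X in eqfps _ _ X]mulrCA mulVKr //.
apply: eqfps_trans; first exact/eqfps_sym/rank_moment2_pentagonal.
apply: eqfpsMl; apply: eqfps_sym.
under [X in eqfps _ _ X]eq_bigr do rewrite -pE.
(* The truncation needs only a factor q^n, taken out of q^(3n). *)
rewrite -(sum_shift _ (fun n => (rank_moment2 n)%:~R * q ^+ (3 * n))).
apply: (sum_trunc _ _ (fun n => (rank_moment2 n)%:~R * q ^+ (2 * n))) => n.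
by rewrite mulrCA -exprD mulSn.
Qed.
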